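(* Let $V\subseteq W$ be operator spaces with $W$ admissible, and let $E:W\to W$ be a $V$-map. Then the following are equivalent: (i) $p_E$ is a minimal $V$-seminorm; (ii) $E$ is a projection onto a $W$-injective, $W$-rigid extension of $V$; (iii) $E$ is minimal in the partial order $\preceq$ on $V$-projections. Moreover, if $E_1,E_2$ are two such minimal $V$-projections, then their ranges $\mathcal R(E_1)$ and $\mathcal R(E_2)$ are $W$-isomorphic.
   Context: Let $W$ be an operator space. For operator subspaces $X,Y\subseteq W$, let $M(X,Y)$ be the set of completely contractive (linear) maps $\phi:W\to W$ with $\phi(X)\subseteq Y$. A subspace $Y\subseteq W$ is $W$-injective if whenever $X_1\subseteq X_2\subseteq W$ and $\phi_1\in M(X_1,Y)$ there is $\phi_2\in M(X_2,Y)$ with $\phi_2|_{X_1}=\phi_1|_{X_1}$; equivalently, there is a completely contractive idempotent from $W$ onto $Y$. $X$ and $Y$ are $W$-isomorphic if there are $\phi\in M(X,Y)$, $\psi\in M(Y,X)$ with $\psi\circ\phi$ the identity on $X$ and $\phi\circ\psi$ the identity on $Y$. For $V\subseteq W$, a $V$-map is a completely contractive map $\phi:W\to W$ with $\phi(v)=v$ for all $v\in V$. A $V$-projection is an idempotent $V$-map; for $V$-projections, $E\preceq F$ means $E\circ F=F\circ E=E$. A subspace $X$ with $V\subseteq X\subseteq W$ is a $W$-rigid extension of $V$ if every $V$-map in $M(X,X)$ restricts to the identity on $X$. Each $V$-map $\phi$ induces a seminorm $p_\phi(w)=\|\phi(w)\|$ on $W$ (a $V$-seminorm); these are ordered pointwise,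 and minimality of $p_\phi$ is with respect to this order among all $p_\psi$, $\psi$ a $V$-map. $W$ is admissible if for every operator subspace $V$ of $W$ and every $V$-map $\phi$ there is a $V$-map $\psi$ with $p_\psi\le p_\phi$ and $p_\psi$ minimal. *)

(* Defs.v *)
From HB Require Import structures.
From mathcomp Require Import all_boot all_order all_algebra.
From mathcomp Require Import complex.
From mathcomp Require Import boolp classical_sets reals.
Set Implicit Arguments. Unset Strict Implicit. Unset Printing Implicit Defensive.
Import Order.TTheory GRing.Theory Num.Theory.
Import ComplexField.Normc.
Local Open Scope classical_set_scope.
Local Open Scope ring_scope.
Local Open Scope complex_scope.

(* Norms are valued in R, so moduli of complex numbers are taken with normc
   rather than with the R[i]-valued `|_|. *)
Definition l2norm (R : realType) (n : nat) (v : 'cV[R[i]]_n) : R :=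
  Num.sqrt (\sum_i normc (v i 0) ^+ 2).

Definition opnorm (R : realType) (m n : nat) (a : 'M[R[i]]_(m, n)) : R :=
  sup [set l2norm (a *m v) | v in [set v : 'cV[R[i]]_n | l2norm v <= 1]].

(* The products of a scalar matrix and a matrix of vectors; the product
   *m of the library needs both matrices to have entries in the same ring. *)
Definition lscalemx (K : pzRingType) (W : lmodType K) (m n p : nat)
    (a : 'M[K]_(m, n)) (x : 'M[W]_(n, p)) : 'M[W]_(m, p) :=
  \matrix_(i, j) \sum_k a i k *: x k j.

Definition rscalemx (K : pzRingType) (W : lmodType K) (m n p : nat)
    (x : 'M[W]_(m, n)) (b : 'M[K]_(n, p)) : 'M[W]_(m, p) :=
  \matrix_(i, j) \sum_k b k j *: x i k.

(* Abstract (complex) operator spaces: a norm on each M_n(W), subject to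
   Ruan's axioms.  No completeness is assumed. *)
HB.mixin Record Lmodule_isOperatorSpace (R : realType) W
    & GRing.Lmodule R[i] W := {
  mxnorm : forall n : nat, 'M[W]_n -> R;
  ler_mxnormD : forall (n : nat) (x y : 'M[W]_n),
    mxnorm n (x + y) <= mxnorm n x + mxnorm n y;
  mxnormZ : forall (n : nat) (a : R[i]) (x : 'M[W]_n),
    mxnorm n (map_mx ( *:%R a) x) = normc a * mxnorm n x;
  mxnorm0_eq0 : forall (n : nat) (x : 'M[W]_n), mxnorm n x = 0 -> x = 0;
  mxnorm_block_diag : forall (m n : nat) (x : 'M[W]_m) (y : 'M[W]_n),
    mxnorm (m + n) (block_mx x 0 0 y) = Num.max (mxnorm m x) (mxnorm n y);
  ler_mxnormM : forall (m n : nat) (a : 'M[R[i]]_(m, n)) (x : 'M[W]_n)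
      (b : 'M[R[i]]_(n, m)),
    mxnorm m (rscalemx (lscalemx a x) b) <= opnorm a * mxnorm n x * opnorm b
}.

#[short(type="operatorSpaceType")]
HB.structure Definition OperatorSpace (R : realType) :=
  {W of Lmodule_isOperatorSpace R W & GRing.Lmodule R[i] W}.

(* W is identified with M_1(W). *)
Definition opspace_norm (R : realType) (W : operatorSpaceType R) (w : W) : R :=
  mxnorm 1 (const_mx w).

(* Operator subspaces are linear subspaces, not required to be closed. *)
Definition is_subspace (R : realType) (W : operatorSpaceType R) (X : set W) :=
  submod_closed (mem X).

Definition completely_contractive (R : realType) (W : operatorSpaceType R)
    (phi : {linear W -> W}) :=
  forall (n : nat) (x : 'M[W]_n), mxnorm n (map_mx phi x) <= mxnorm n x.

Definition maps_into (R : realType) (W : operatorSpaceType R) (X Y : set W) :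
    set {linear W -> W} :=
  [set phi | completely_contractive phi /\ phi @` X `<=` Y].

Definition W_injective (R : realType) (W : operatorSpaceType R) (Y : set W) :=
  is_subspace Y /\
  forall X1 X2 : set W, is_subspace X1 -> is_subspace X2 -> X1 `<=` X2 ->
  forall phi1, maps_into X1 Y phi1 ->
  exists2 phi2, maps_into X2 Y phi2 & {in X1, phi2 =1 phi1}.

Definition W_isomorphic (R : realType) (W : operatorSpaceType R)
    (X Y : set W) :=
  exists phi psi, [/\ maps_into X Y phi, maps_into Y X psi,
    {in X, cancel phi psi} & {in Y, cancel psi phi}].

Definition V_map (R : realType) (W : operatorSpaceType R) (V : set W)
    (phi : {linear W -> W}) :=
  completely_contractive phi /\ {in V, phi =1 id}.

Definition V_projection (R : realType) (W : operatorSpaceType R) (V : set W)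
    (E : {linear W -> W}) :=
  V_map V E /\ E \o E =1 E.

Definition proj_le (R : realType) (W : operatorSpaceType R)
    (E F : {linear W -> W}) :=
  E \o F =1 E /\ F \o E =1 E.

Definition minimal_V_projection (R : realType) (W : operatorSpaceType R)
    (V : set W) (E : {linear W -> W}) :=
  V_projection V E /\
  forall F : {linear W -> W}, V_projection V F -> proj_le F E -> F =1 E.

Definition W_rigid_extension (R : realType) (W : operatorSpaceType R)
    (V X : set W) :=
  [/\ is_subspace X, V `<=` X &
    forall phi, V_map V phi -> maps_into X X phi -> {in X, phi =1 id}].

Definition V_seminorm (R : realType) (W : operatorSpaceType R)
    (phi : {linear W -> W}) (w : W) : R :=
  opspace_norm (phi w).

Definition seminorm_le (R : realType) (W : Type) (p q : W -> R) :=
  forall w, p w <= q w.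

(* phi is a V-map and p_phi is minimal among the p_psi, psi a V-map. *)
Definition minimal_V_seminorm (R : realType) (W : operatorSpaceType R)
    (V : set W) (phi : {linear W -> W}) :=
  V_map V phi /\
  forall psi : {linear W -> W}, V_map V psi ->
    seminorm_le (V_seminorm psi) (V_seminorm phi) ->
    V_seminorm psi =1 V_seminorm phi.

Definition admissible (R : realType) (W : operatorSpaceType R) :=
  forall V : set W, is_subspace V -> forall phi, V_map V phi ->
  exists psi, seminorm_le (V_seminorm psi) (V_seminorm phi) /\
    minimal_V_seminorm V psi.

(* Main.v *)
Require Import Defs.
From HB Require Import structures.
From mathcomp Require Import all_boot all_order all_algebra.
From mathcomp Require Import complex.
From mathcomp Require Import boolp classical_sets reals.
From mathcomp Require Import lra.
Import Order.TTheory GRing.Theory Num.Theory.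
Import ComplexField.Normc.
Local Open Scope classical_set_scope.
Local Open Scope ring_scope.

(** Since V-maps are contractive, composing on the left with a V-map can only
    decrease a V-seminorm; so if [p_E] is minimal and [phi] is a V-map, then
    [p_(phi \o E) = p_E] and [phi \o E] is again minimal.  Everything follows
    from this remark.

    Minimality forces idempotence (lemma [minimal_V_seminorm_idem]): taking for
    [phi] the Cesaro mean [A] of the first n powers of E gives
    [|E (x - E x)| = |A (E (x - E x))|], and the right-hand side telescopes to
    [|E x - E^(n+1) x| / n <= 2 |x| / n], which tends to 0.
    It also forces rigidity (lemma [minimal_V_seminorm_rigid]): if the V-map
    [phi] preserves the range of E, then [phi \o E] is minimal, hence
    idempotent, so it kills [phi (E x) - E x]; as [p_(phi \o E) = p_E], so does
    E, which fixes that vector.  The range is injective because the maps to be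
    extended are already defined on W: composing them with the projection E
    brings all their values into the range.

    A rigid projection E is minimal for the order on V-projections because any
    [F] below E preserves the range of E, where rigidity makes it the identity.
    Conversely, given a minimal V-projection E, admissibility provides a
    minimal [psi] with [p_psi <= p_E]; then [E \o psi] is minimal, hence a
    V-projection, and it lies below E, so it equals E
    (lemma [minimal_V_projection_seminorm]).

    Finally, for two minimal V-projections, rigidity of each range shows that
    the restrictions of [E1] and [E2] to the range of the other are mutually
    inverse. *)

(** * Matrix norms *)

Section MatrixNorm.
Context {R : realType} {W : operatorSpaceType R}.

Lemma mxnorm0 n : mxnorm n (0 : 'M[W]_n) = 0.
Proof.
have := mxnormZ n 0 (0 : 'M[W]_n).
rewrite normc0 mul0r => <-; congr mxnorm.
by apply/matrixP => i j; rewrite !mxE scale0r.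
Qed.

Lemma mxnormN n (x : 'M[W]_n) : mxnorm n (- x) = mxnorm n x.
Proof.
have := mxnormZ n (- 1) x.
rewrite normcN normc1 mul1r => <-; congr mxnorm.
by apply/matrixP => i j; rewrite !mxE scaleN1r.
Qed.

Lemma mxnorm_ge0 n (x : 'M[W]_n) : 0 <= mxnorm n x.
Proof. by have := ler_mxnormD n x (- x); rewrite subrr mxnorm0 mxnormN; lra. Qed.

Lemma ler_mxnorm_sum n m (F : 'I_m -> 'M[W]_n) :
  mxnorm n (\sum_i F i) <= \sum_i mxnorm n (F i).
Proof.
elim/big_ind2: _ => [|x a y b xa yb|//]; first by rewrite mxnorm0.
exact: le_trans (ler_mxnormD _ _ _) (lerD xa yb).
Qed.

Lemma opspace_norm0_eq0 (w : W) : opspace_norm w = 0 -> w = 0.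
Proof. by move=> /mxnorm0_eq0/matrixP/(_ 0 0); rewrite !mxE. Qed.

Lemma opspace_norm0 : opspace_norm (0 : W) = 0.
Proof. exact: mxnorm0. Qed.

Lemma opspace_norm_ge0 (w : W) : 0 <= opspace_norm w.
Proof. exact: mxnorm_ge0. Qed.

Lemma ler_opspace_normB (v w : W) :
  opspace_norm (v - w) <= opspace_norm v + opspace_norm w.
Proof.
have := ler_mxnormD 1 (const_mx v) (- const_mx w).
by rewrite mxnormN -raddfB.
Qed.

Lemma opspace_normZ (a : R[i]) (w : W) :
  opspace_norm (a *: w) = normc a * opspace_norm w.
Proof. by rewrite /opspace_norm -mxnormZ map_const_mx. Qed.

Lemma normc_natV n : normc (n.+1%:R^-1 : R[i]) = n.+1%:R^-1.
Proof.
rewrite normcV; congr (_^-1).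
have -> : (n.+1%:R : R[i]) = (n.+1%:R : R)%:C%C by rewrite rmorph_nat.
by rewrite /= expr0n addr0 sqrtr_sqr ger0_norm.
Qed.

Lemma ler_natV_eq0 (a b : R) :
  0 <= a -> (forall n, a <= n.+1%:R^-1 * b) -> a = 0.
Proof.
move=> a0 ab; apply/eqP; rewrite eq_le a0 andbT leNgt; apply/negP => agt0.
have := ab (Num.bound (b / a)); rewrite mulrC ler_pdivlMr// leNgt => /negP; apply.
rewrite mulrC -ltr_pdivrMr//.
have b0 : 0 <= b by have := ab 0%N; rewrite invr1 mul1r; exact: le_trans.
apply: lt_trans (archi_boundP _) _; first by rewrite divr_ge0.
by rewrite ltr_nat.
Qed.

End MatrixNorm.

(** * Completely contractive maps and V-maps *)

Section VMaps.
Context {R : realType} {W : operatorSpaceType R}.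
Implicit Types (phi psi E F : {linear W -> W}) (V X : set W).

Lemma completely_contractive_opspace_norm phi w : completely_contractive phi ->
  opspace_norm (phi w) <= opspace_norm w.
Proof. by move=> /(_ 1%N (const_mx w)); rewrite map_const_mx. Qed.

Lemma completely_contractive_comp phi psi : completely_contractive phi ->
  completely_contractive psi -> completely_contractive (phi \o psi).
Proof. by move=> cphi cpsi n x; rewrite map_mx_comp; apply: le_trans (cpsi n x). Qed.

Lemma V_map_comp V phi psi : V_map V phi -> V_map V psi -> V_map V (phi \o psi).
Proof.
move=> [cphi phiV] [cpsi psiV]; split; first exact: completely_contractive_comp.
by move=> v vV; rewrite /= psiV ?phiV.
Qed.

Definition cesaro_mean E (n : nat) (x : W) : W :=
  n.+1%:R^-1 *: \sum_(i < n.+1) iter i E x.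

Lemma iter_linear E i : linear (iter i E).
Proof. by elim: i => [|i IHi] a x y //=; rewrite IHi linearP. Qed.

Lemma cesaro_mean_is_linear E n : linear (cesaro_mean E n).
Proof.
move=> a x y; rewrite /cesaro_mean !scalerA [a * _]mulrC -scalerA -scalerDr.
congr (_ *: _); rewrite scaler_sumr -big_split.
by apply: eq_bigr => i _; rewrite iter_linear.
Qed.

HB.instance Definition _ E n :=
  GRing.isLinear.Build R[i] W W *:%R (cesaro_mean E n) (cesaro_mean_is_linear E n).

Lemma V_map_cesaro V E n : V_map V E -> V_map V (cesaro_mean E n).
Proof.
move=> [cE EV]; split=> [m x|v vV].
  have -> : map_mx (cesaro_mean E n) x =
      map_mx ( *:%R n.+1%:R^-1) (\sum_(i < n.+1) map_mx (iter i E) x).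
    apply/matrixP => j k; rewrite !mxE summxE; congr (_ *: _).
    by apply: eq_bigr => i _; rewrite mxE.
  rewrite mxnormZ normc_natV ler_pdivrMl ?ltr0Sn//.
  apply: le_trans (ler_mxnorm_sum _ _ _) _.
  have -> : n.+1%:R * mxnorm m x = \sum_(i < n.+1) mxnorm m x.
    by rewrite sumr_const card_ord mulr_natl.
  apply: ler_sum => i _; elim: (i : nat) => [|k IHk].
    by rewrite map_mx_id.
  have -> : map_mx (iter k.+1 E) x = map_mx E (map_mx (iter k E) x).
    by rewrite -map_mx_comp.
  exact: le_trans (cE _ _) IHk.
rewrite /= /cesaro_mean; have -> : \sum_(i < n.+1) iter i E v = n.+1%:R *: v.
  transitivity (\sum_(i < n.+1) v); last by rewrite sumr_const card_ord scaler_nat.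
  by apply: eq_bigr => i _; elim: (i : nat) => //= k ->; exact: EV.
by rewrite scalerA mulVf ?scale1r// pnatr_eq0.
Qed.

Lemma cesaro_meanB E n x :
  cesaro_mean E n (x - E x) = n.+1%:R^-1 *: (x - iter n.+1 E x).
Proof.
rewrite /cesaro_mean; congr (_ *: _).
rewrite -(big_mkord xpredT (fun i => iter i E (x - E x))).
have tel : \sum_(0 <= i < n.+1) (iter i.+1 E x - iter i E x) = iter n.+1 E x - x.
  exact: (telescope_sumr (fun i => iter i E x)).
rewrite -[RHS]opprB -tel -sumrN; apply: eq_bigr => i _.
by rewrite opprB iterSr addrC -scaleN1r iter_linear scaleN1r addrC.
Qed.

(** * Minimal V-seminorms *)

Lemma V_seminorm_comp_le V phi psi : V_map V phi ->
  seminorm_le (V_seminorm (phi \o psi)) (V_seminorm psi).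
Proof. by move=> [cphi _] w; exact: (completely_contractive_opspace_norm phi). Qed.

Lemma minimal_V_seminorm_comp V phi E : V_map V phi -> minimal_V_seminorm V E ->
  V_seminorm (phi \o E) =1 V_seminorm E.
Proof.
move=> vphi [vE minE]; apply: minE; first exact: V_map_comp.
exact: V_seminorm_comp_le vphi.
Qed.

Lemma minimal_V_seminorm_eq V E F : minimal_V_seminorm V E -> V_map V F ->
  V_seminorm F =1 V_seminorm E -> minimal_V_seminorm V F.
Proof.
move=> [vE minE] vF eqFE; split=> // psi vpsi lepsi w.
rewrite eqFE; apply: minE => // u; rewrite -eqFE; exact: lepsi.
Qed.

(** The means of the powers of E are asymptotically invariant under E, so they
    make [E (x - E x)] arbitrarily small, while minimality prevents them from
    changing its norm. *)
Lemma minimal_V_seminorm_idem V E : minimal_V_seminorm V E -> E \o E =1 E.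
Proof.
move=> minE x; have vE := minE.1.
apply/esym/eqP; rewrite -subr_eq0 /= -raddfB; apply/eqP/opspace_norm0_eq0.
apply: (@ler_natV_eq0 _ _ (opspace_norm x + opspace_norm x)) => [|n].
  exact: opspace_norm_ge0.
have := minimal_V_seminorm_comp _ _ _ (V_map_cesaro V E n vE) minE (x - E x).
rewrite /V_seminorm /= => <-.
rewrite [E (x - E x)]raddfB cesaro_meanB opspace_normZ normc_natV.
apply: ler_wpM2l; first by rewrite invr_ge0 ler0n.
have itE k : opspace_norm (iter k E x) <= opspace_norm x.
  elim: k => //= k; apply: le_trans.
  exact: completely_contractive_opspace_norm vE.1.
apply: le_trans (ler_opspace_normB _ _) _.
by rewrite -iterSr; apply: lerD; [exact: (itE 1%N)|exact: (itE n.+2)].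
Qed.

Lemma range_is_subspace E : is_subspace (range E).
Proof.
split=> [|a x y]; rewrite ?inE; first by exists 0; rewrite ?raddf0.
by move=> [u _ <-] [v _ <-]; exists (a *: u + v); rewrite ?linearP.
Qed.

Lemma V_map_sub_range V E : V_map V E -> V `<=` range E.
Proof. by move=> [_ EV] v vV; exists v => //; apply: EV; rewrite inE. Qed.

Lemma idem_range_id E y : E \o E =1 E -> range E y -> E y = y.
Proof. by move=> EE [x _ <-]; exact: EE. Qed.

Lemma completely_contractive_range_injective E : completely_contractive E ->
  E \o E =1 E -> W_injective (range E).
Proof.
move=> cE EE; split=> [|X1 X2 _ _ _ phi [cphi phiX1]].
  exact: range_is_subspace.
exists (E \o phi).
  split; first exact: completely_contractive_comp.
  by move=> _ [x _ <-]; exists (phi x).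
move=> x; rewrite inE => X1x /=.
by apply: idem_range_id => //; apply: phiX1; exists x.
Qed.

(** For a V-map [phi] preserving the range, the minimal map [phi \o E] is
    idempotent, so it kills [phi (E x) - E x]; having the same seminorm, E kills
    this vector too, although it fixes it. *)
Lemma minimal_V_seminorm_rigid V E : minimal_V_seminorm V E ->
  W_rigid_extension V (range E).
Proof.
move=> minE; have vE := minE.1; have EE := minimal_V_seminorm_idem _ _ minE.
split; [exact: range_is_subspace|exact: V_map_sub_range|].
move=> phi vphi [_ phiE] _ /set_mem[x _ <-].
have phiEx : E (phi (E x)) = phi (E x).
  by apply: idem_range_id => //; apply: phiE; exists (E x) => //; exists x.
have eqp := minimal_V_seminorm_comp _ _ _ vphi minE.
have minphiE : minimal_V_seminorm V (phi \o E).
  exact: minimal_V_seminorm_eq minE (V_map_comp _ _ _ vphi vE) eqp.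
have /= phi_idem := minimal_V_seminorm_idem _ _ minphiE x.
have EEx : E (E x) = E x := EE x.
apply/eqP; rewrite -subr_eq0 -{1}phiEx -[X in _ - X]EEx -raddfB.
apply/eqP/opspace_norm0_eq0.
have := eqp (phi (E x) - E x); rewrite /V_seminorm /= => <-.
by rewrite [E (_ - _)]linearB EEx [phi (_ - _)]linearB phi_idem subrr opspace_norm0.
Qed.

(** * Minimal V-projections *)

Lemma rigid_minimal_V_projection V E : V_projection V E ->
  W_rigid_extension V (range E) -> minimal_V_projection V E.
Proof.
move=> vE [_ _ rigE]; split=> // F [vF _] [FE EF] x.
rewrite -FE /=; apply: rigE => //; last by rewrite inE; exists x.
split; first exact: vF.1.
by move=> _ [y _ <-]; exists (F y) => //; exact: EF.
Qed.

(** The seminorm bound [p_psi <= p_E] says in particular that the kernel of E is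
    contained in that of [psi]; this is what puts [E \o psi] below E. *)
Lemma minimal_V_projection_seminorm V E : is_subspace V -> admissible W ->
  minimal_V_projection V E -> minimal_V_seminorm V E.
Proof.
move=> hV hW [[vE EE] minE].
have [psi [lepsi minpsi]] := hW V hV E vE.
have eqp := minimal_V_seminorm_comp _ _ _ vE minpsi.
have vF : V_map V (E \o psi) := V_map_comp _ _ _ vE minpsi.1.
have minF : minimal_V_seminorm V (E \o psi) := minimal_V_seminorm_eq _ _ _ minpsi vF eqp.
have FE : E \o psi =1 E.
  apply: minE; first by split=> //; exact: minimal_V_seminorm_idem minF.
  split=> x /=; last exact: EE.
  have psi_ker : psi (x - E x) = 0.
    apply/opspace_norm0_eq0/eqP; rewrite eq_le opspace_norm_ge0 andbT.
    apply: le_trans (lepsi _) _.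
    rewrite /V_seminorm raddfB; have /= -> := EE x.
    by rewrite subrr opspace_norm0.
  by move/eqP: psi_ker; rewrite raddfB subr_eq0 => /eqP ->.
by apply: minimal_V_seminorm_eq minF vE _ => x; congr opspace_norm; exact/esym/FE.
Qed.

Lemma rigid_ranges_isomorphic V E1 E2 : V_map V E1 -> V_map V E2 ->
  W_rigid_extension V (range E1) -> W_rigid_extension V (range E2) ->
  W_isomorphic (range E1) (range E2).
Proof.
move=> v1 v2 [_ _ rig1] [_ _ rig2].
have into (E : {linear W -> W}) X : V_map V E -> maps_into X (range E) E.
  by move=> [cE _]; split=> // _ [x _ <-]; exists x.
have v12 := V_map_comp _ _ _ v1 v2; have v21 := V_map_comp _ _ _ v2 v1.
exists E2, E1; split; [exact: into|exact: into| |].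
- apply: (rig1 _ v12); split; first exact: v12.1.
  by move=> _ [x _ <-]; exists (E2 x).
- apply: (rig2 _ v21); split; first exact: v21.1.
  by move=> _ [x _ <-]; exists (E1 x).
Qed.

End VMaps.

Theorem theorem2p9 (R : realType) (W : operatorSpaceType R) (V : set W)
    (hV : is_subspace V) (hW : admissible W) :
  (forall E : {linear W -> W}, V_map V E ->
     [<-> minimal_V_seminorm V E;
          E \o E =1 E /\ W_injective (range E) /\ W_rigid_extension V (range E);
          minimal_V_projection V E]) /\
  (forall E1 E2 : {linear W -> W},
     minimal_V_projection V E1 -> minimal_V_projection V E2 ->
     W_isomorphic (range E1) (range E2)).
Proof.
split=> [E vE|E1 E2 min1 min2].
  tfae.
  - move=> minE; have EE := minimal_V_seminorm_idem _ _ minE.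
    split=> //; split; last exact: minimal_V_seminorm_rigid.
    exact: completely_contractive_range_injective vE.1 EE.
  - by move=> [EE [_ rigE]]; exact: rigid_minimal_V_projection.
  - exact: minimal_V_projection_seminorm.
apply: rigid_ranges_isomorphic min1.1.1 min2.1.1 _ _.
  exact/minimal_V_seminorm_rigid/minimal_V_projection_seminorm.
exact/minimal_V_seminorm_rigid/minimal_V_projection_seminorm.
Qed.
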